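(* Let $\mathcal{S}$ be a scoring procedure whose domain is the set of all indivisible preference profiles (with arbitrary finite numbers of alternatives and individuals). If $\mathcal{S}$ is a win-loss combining scoring procedure, then $\mathcal{S}$ does not satisfy Self-Consistent Monotonicity (SCM).
   Context: **Profiles.** $J=\{1,\dots,n\}$ is a finite set of alternatives and there are $m\ge 1$ individuals. Individual $p$ gives an incomplete paired comparison matrix $A^{(p)}=[a_{ij}^p]$: for $i\ne j$, either the comparison is unreported and $a_{ij}^p,a_{ji}^p$ are both undefined, or $(a_{ij}^p,a_{ji}^p)\in\{(1,0),(0,1),(1/2,1/2)\}$ (respectively $i$ is better than $j$, $j$ is better than $i$, $i$ and $j$ are equivalent). Diagonal entries are $a_{ii}^p=0$. No transitivity is assumed. A profile is $\mathcal{A}=(A^{(1)},\dots,A^{(m)})$. Put $a_{ij}=\sum_p a_{ij}^p$, the sum being over those $p$ for which $a_{ij}^p$ is defined, and $a_{ij}=0$ if there are none. Put $c_i^{+}=\sum_{j=1}^n a_{ij}$ and $c_i^{-}=\sum_{j=1}^n a_{ji}$. The profile is *indivisible* if $J$ cannot be split into two nonempty parts $J_1,J_2$ such that $a_{ji}>0$ for no $j\in J_2$, $i\in J_1$. **Scoring procedures.** A scoring procedure $\mathcal{S}$ assigns to every profile $\mathcal{A}$ of its domain a vector $s=(s_1,\dots,s_n)^{\top}\in\mathbb{R}^n$ of scores. Scoring procedures are assumed neutral (reindexing the alternatives preserves their scores) and anonymous (reindexing the individuals preserves the scores). **Self-Consistent Monotonicity (SCM).** $\mathcal{S}$ satisfies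 SCM if for every set of alternatives $J$, every profile $\mathcal{A}$ in the domain and all $i,j\in J$ the following holds. Let $U_i=\langle a_{ik}^p\mid k,p\rangle$ and $U_j=\langle a_{j\ell}^q\mid \ell,q\rangle$ be the multisets of comparison outcomes of $i$ and of $j$ (over all $k\neq i$ and all $p$ with $a_{ik}^p$ defined, and over all $\ell\ne j$ and all $q$ with $a_{j\ell}^q$ defined; each element is remembered together with its indices). Suppose $U_i$ can be split into $U_i^{I}$ and $U_i^{II}$, and $U_j$ into $U_j^{I}$ and $U_j^{II}$ (parts may be empty), so that: (i) $a_{ik}^p\in U_i^I$ implies $a_{ik}^p=1$, and $a_{j\ell}^q\in U_j^I$ implies $a_{j\ell}^q=0$; (ii) there is a one-to-one correspondence $\pi$ of $U_i^{II}$ onto $U_j^{II}$ such that $\pi(a_{ik}^p)=a_{j\ell}^q$ implies $a_{ik}^p\ge a_{j\ell}^q$ and $s_k\ge s_\ell$. Then $s_i\ge s_j$. Moreover, if in addition $U_i^I$ is nonempty, or $U_j^I$ is nonempty, or at least one inequality in (ii) is strict at least once, then $s_i>s_j$. **Win-loss indices.** Fix a profile $\mathcal{A}$. ''Vector'' means $n$-component real column vector; angle brackets denote multisets; all functions below are arbitrary real-valued functions (with $\alpha,\beta$ nonzero where they are divided by). *Finite order* (recursive). A pair of vectors $(w,\ell)$ is a win-loss index of order $0$ if $w=\ell=(1,\dots,1)^{\top}$. For $k\ge1$, $(w,\ell)$ is a win-loss index of order $k$ if there exist a win-loss index $(w',\ell')$ of order $k-1$ and functions $f,g,\alpha,\beta$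 such that for all $i=1,\dots,n$ $$w_i=\frac{1}{\alpha(c_i^{+},c_i^{-})}f(W'_i),\qquad \ell_i=\frac{1}{\beta(c_i^{-},c_i^{+})}g(L'_i),$$ where $W'_i=\langle(a_{i1},w'_1),\dots,(a_{in},w'_n)\rangle$ and $L'_i=\langle(a_{1i},\ell'_1),\dots,(a_{ni},\ell'_n)\rangle$. *Infinite order.* $(w,\ell)$ is a win-loss index of infinite order if there exist functions $f,g,\alpha,\beta$ such that for all $i=1,\dots,n$ $$w_i=\frac{1}{\alpha(c_i^{+},c_i^{-})}f(W_i),\qquad \ell_i=\frac{1}{\beta(c_i^{-},c_i^{+})}g(L_i),$$ where $W_i=\langle(a_{i1},w_1),\dots,(a_{in},w_n)\rangle$ and $L_i=\langle(a_{1i},\ell_1),\dots,(a_{ni},\ell_n)\rangle$. *Win-loss index.* $(w,\ell)$ is a win-loss index if there exist a sequence $((w^1,\ell^1),(w^2,\ell^2),\dots)$ of win-loss indices of finite or infinite order and functions $\varphi,\psi$ such that for all $i=1,\dots,n$ $$w_i=\varphi(w_i^1,\ell_i^1,w_i^2,\ell_i^2,\dots),\qquad \ell_i=\psi(w_i^1,\ell_i^1,w_i^2,\ell_i^2,\dots).$$ **Win-loss combining scoring procedure.** $\mathcal{S}$ is a win-loss combining scoring procedure if for any profile $\mathcal{A}$ (in its domain) there exist a win-loss index $(w,\ell)$ and a function $h$ such that $s_i=h(w_i,\ell_i)$ for $i=1,\dots,n$. *)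

(* Defs.v *)
From HB Require Import structures.
From mathcomp Require Import all_boot all_order all_fingroup all_algebra.
From mathcomp Require Import finmap multiset reals.
Set Implicit Arguments.
Unset Strict Implicit.
Unset Printing Implicit Defensive.
Import Order.TTheory GRing.Theory Num.Theory.
Local Open Scope ring_scope.

(* [None] stands for an unreported comparison. *)
Definition admissible_pair (R : realType) (x y : option R) : bool :=
  (x, y) \in [:: (None, None); (Some 1, Some 0); (Some 0, Some 1);
                 (Some (1 / 2), Some (1 / 2))].

Record profile (R : realType) (n m : nat) := Profile {
  comparisons :> {ffun 'I_m -> 'M[option R]_n};
  profile_individuals : (0 < m)%N;
  profile_diag : [forall p, forall i, comparisons p i i == Some 0];
  profile_pairs : [forall p, forall i, forall j,
    (i != j) ==> admissible_pair (comparisons p i j) (comparisons p j i)] }.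

Section Profiles.
Context {R : realType} {n m : nat}.
Implicit Types (A : profile R n m) (w l s : 'cV[R]_n) (i j : 'I_n).

Definition pooled A i j : R := \sum_(p < m | A p i j) odflt 0 (A p i j).

Definition cplus A i : R := \sum_(j < n) pooled A i j.

Definition cminus A i : R := \sum_(j < n) pooled A j i.

Definition indivisible A : Prop :=
  ~ exists J1 J2 : {set 'I_n},
      [/\ J1 != set0, J2 != set0, J1 :|: J2 = setT, [disjoint J1 & J2] &
          forall j i, j \in J2 -> i \in J1 -> ~ 0 < pooled A j i].

(* The outcomes of [i], remembered together with their indices: the pair
   [(k, p)] stands for the comparison of [i] with [k] reported by [p]. *)
Definition outcomes A i : {set 'I_n * 'I_m} :=
  [set x : 'I_n * 'I_m | (x.1 != i) && A x.2 i x.1].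

Definition outcome A i (x : 'I_n * 'I_m) : R := odflt 0 (A x.2 i x.1).

Definition scm_matching A s i j (UI1 UI2 UJ1 UJ2 : {set 'I_n * 'I_m})
    (pi : 'I_n * 'I_m -> 'I_n * 'I_m) : Prop :=
  [/\ UI1 :|: UI2 = outcomes A i /\ [disjoint UI1 & UI2],
      UJ1 :|: UJ2 = outcomes A j /\ [disjoint UJ1 & UJ2],
      (forall x, x \in UI1 -> outcome A i x = 1) /\
      (forall y, y \in UJ1 -> outcome A j y = 0),
      {in UI2 &, injective pi} /\ pi @: UI2 = UJ2 &
      forall x, x \in UI2 ->
        outcome A j (pi x) <= outcome A i x /\ s (pi x).1 0 <= s x.1 0].

Definition scm_strict A s i j (UI1 UI2 UJ1 : {set 'I_n * 'I_m})
    (pi : 'I_n * 'I_m -> 'I_n * 'I_m) : Prop :=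
  [\/ UI1 != set0, UJ1 != set0 |
      exists2 x, x \in UI2 &
        outcome A j (pi x) < outcome A i x \/ s (pi x).1 0 < s x.1 0].

Definition win_mset A w i : {mset R * R}%mset :=
  seq_mset [seq (pooled A i j, w j 0) | j <- enum 'I_n].

Definition loss_mset A l i : {mset R * R}%mset :=
  seq_mset [seq (pooled A j i, l j 0) | j <- enum 'I_n].

Definition win_loss_step A (w' l' w l : 'cV[R]_n) : Prop :=
  exists (f g : {mset R * R}%mset -> R) (alpha beta : R -> R -> R),
  forall i,
    [/\ alpha (cplus A i) (cminus A i) != 0,
        beta (cminus A i) (cplus A i) != 0,
        w i 0 = 1 / alpha (cplus A i) (cminus A i) * f (win_mset A w' i) &
        l i 0 = 1 / beta (cminus A i) (cplus A i) * g (loss_mset A l' i)].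

Fixpoint win_loss_index_order A (k : nat) w l : Prop :=
  if k is k'.+1 then
    exists w' l', win_loss_index_order A k' w' l' /\ win_loss_step A w' l' w l
  else w = const_mx 1 /\ l = const_mx 1.

Definition win_loss_index_infinite A w l : Prop := win_loss_step A w l w l.

(* A finite sequence of indices is covered by repeating its last term (or, if
   it is empty, by the index of order 0), as [phi] and [psi] need not depend on
   all their arguments. *)
Definition win_loss_index A w l : Prop :=
  exists (ws ls : nat -> 'cV[R]_n) (phi psi : (nat -> R * R) -> R),
    (forall t, (exists k, win_loss_index_order A k (ws t) (ls t)) \/
               win_loss_index_infinite A (ws t) (ls t)) /\
    forall i, w i 0 = phi (fun t => (ws t i 0, ls t i 0)) /\
              l i 0 = psi (fun t => (ws t i 0, ls t i 0)).

End Profiles.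

Definition profile_domain (R : realType) :=
  forall n m : nat, profile R n m -> Prop.

Definition all_indivisible (R : realType) : profile_domain R :=
  fun n m A => indivisible A.

(* A procedure with domain [D] is a total function whose values outside [D] are
   irrelevant: every property below only looks at profiles in [D]. *)
Definition scoring_map (R : realType) :=
  forall n m : nat, profile R n m -> 'cV[R]_n.

Section Procedures.
Context {R : realType}.
Implicit Types (D : profile_domain R) (S : scoring_map R).

(* [B] is [A] with alternative [i] renamed [sigma i]. *)
Definition neutral D S : Prop :=
  forall (n m : nat) (sigma : 'S_n) (A B : profile R n m),
    D n m A -> D n m B ->
    (forall p i j, B p (sigma i) (sigma j) = A p i j) ->
    forall i, S n m B (sigma i) 0 = S n m A i 0.

Definition anonymous D S : Prop :=
  forall (n m : nat) (tau : 'S_m) (A B : profile R n m),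
    D n m A -> D n m B ->
    (forall p, B (tau p) = A p) -> S n m B = S n m A.

Definition scoring_procedure D S : Prop := neutral D S /\ anonymous D S.

Definition self_consistent_monotone D S : Prop :=
  forall (n m : nat) (A : profile R n m), D n m A ->
  forall (i j : 'I_n) (UI1 UI2 UJ1 UJ2 : {set 'I_n * 'I_m})
         (pi : 'I_n * 'I_m -> 'I_n * 'I_m),
    scm_matching A (S n m A) i j UI1 UI2 UJ1 UJ2 pi ->
    S n m A j 0 <= S n m A i 0 /\
    (scm_strict A (S n m A) i j UI1 UI2 UJ1 pi ->
     S n m A j 0 < S n m A i 0).

Definition win_loss_combining D S : Prop :=
  forall (n m : nat) (A : profile R n m), D n m A ->
  exists (w l : 'cV[R]_n) (h : R -> R -> R),
    win_loss_index A w l /\ forall i, S n m A i 0 = h (w i 0) (l i 0).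

End Procedures.

(* Main.v *)
Require Import Defs.
From HB Require Import structures.
From mathcomp Require Import all_boot all_order all_fingroup all_algebra.
From mathcomp Require Import finmap multiset reals.
Set Implicit Arguments.
Unset Strict Implicit.
Unset Printing Implicit Defensive.
Import Order.TTheory GRing.Theory Num.Theory.
Local Open Scope ring_scope.

(** A win-loss index evaluates wins and losses separately, so it cannot see that
    the alternative one beats is the same one that has good losses.  On the
    one-individual profile with wins 0 -> 1, 2, 3, 4, 1 -> 5, 2 -> 6, 3 -> 5,
    4 -> 6, 3 -> 4, 5 -> 0 and 6 -> 0, alternatives 5 and 6 have the same wins,
    hence the same [w]; so do 1 and 2, which beat 5 and 6 respectively, and as
    1 and 2 have the same losses they share [l] too, whence [s_1 = s_2].
    Under SCM, [s_5 <> s_6] would separate [s_1] from [s_2].  But if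
    [s_5 = s_6], then [s_3 > s_4] since 3 beats 4, and comparing the losses of
    5 (to 1 and 3) with those of 6 (to 2 and 4) yields [s_5 > s_6]. *)

(** * Win-loss indices under symmetries of the pooled matrix *)

Section Reindexing.
Context {R : realType} {n m : nat}.
Implicit Types (A : profile R n m) (w l : 'cV[R]_n) (sigma : 'I_n -> 'I_n).

Lemma seq_mset_enum_reindex (K : choiceType) (F G : 'I_n -> K) sigma :
  injective sigma -> (forall j, G (sigma j) = F j) ->
  seq_mset [seq G j | j <- enum 'I_n] = seq_mset [seq F j | j <- enum 'I_n].
Proof.
move=> sigma_inj GF; apply/eq_seq_msetP; rewrite -(eq_map GF) (map_comp G sigma).
apply: perm_map; apply: uniq_perm; rewrite ?(map_inj_uniq sigma_inj) ?enum_uniq //.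
move=> j; rewrite mem_enum; symmetry.
by rewrite -[j](f_invF sigma_inj) map_f // mem_enum.
Qed.

Lemma win_mset_reindex A w i k sigma :
  injective sigma -> (forall j, pooled A k (sigma j) = pooled A i j) ->
  (forall j, w (sigma j) 0 = w j 0) -> win_mset A w k = win_mset A w i.
Proof.
by move=> inj Ak wj; apply: seq_mset_enum_reindex inj _ => j; rewrite Ak wj.
Qed.

Lemma cplus_reindex A i k sigma :
  injective sigma -> (forall j, pooled A k (sigma j) = pooled A i j) ->
  cplus A k = cplus A i.
Proof.
by move=> inj Ak; rewrite /cplus (reindex_inj inj); apply: eq_bigr => j _.
Qed.

Lemma cminus_reindex A i k sigma :
  injective sigma -> (forall j, pooled A (sigma j) k = pooled A j i) ->
  cminus A k = cminus A i.
Proof.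
by move=> inj Ak; rewrite /cminus (reindex_inj inj); apply: eq_bigr => j _.
Qed.

Lemma loss_mset_same_losses A l i k :
  (forall j, pooled A j k = pooled A j i) -> loss_mset A l k = loss_mset A l i.
Proof. by move=> Ak; congr seq_mset; apply: eq_map => j; rewrite Ak. Qed.

Lemma step_win_eq A w' l' w l i k :
  win_loss_step A w' l' w l -> cplus A k = cplus A i -> cminus A k = cminus A i ->
  win_mset A w' k = win_mset A w' i -> w k 0 = w i 0.
Proof.
case=> f [g [alpha [beta E]]] Ep Em Ew.
by have [_ _ -> _] := E i; have [_ _ -> _] := E k; rewrite Ep Em Ew.
Qed.

Lemma step_loss_eq A w' l' w l i k :
  win_loss_step A w' l' w l -> cplus A k = cplus A i -> cminus A k = cminus A i ->
  loss_mset A l' k = loss_mset A l' i -> l k 0 = l i 0.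
Proof.
case=> f [g [alpha [beta E]]] Ep Em El.
by have [_ _ _ ->] := E i; have [_ _ _ ->] := E k; rewrite Ep Em El.
Qed.

(* [a] and [b] have equal wins, so they share [w]; [i] and [k] have equal losses
   and equal wins up to exchanging [a] and [b], so they share [w] and [l]. *)
Lemma win_loss_index_eq A w l a b i k :
  cplus A b = cplus A a -> cminus A b = cminus A a ->
  cplus A k = cplus A i -> cminus A k = cminus A i ->
  (forall j, pooled A b j = pooled A a j) ->
  (forall j, pooled A k (tperm a b j) = pooled A i j) ->
  (forall j, pooled A j k = pooled A j i) ->
  win_loss_index A w l -> w k 0 = w i 0 /\ l k 0 = l i 0.
Proof.
move=> pab mab pik mik ab_wins ik_wins ik_losses.
(* Whatever [w'] is, the identical rows of [a] and [b] yield identical multisets. *)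
have step_ab w' l' w0 l0 : win_loss_step A w' l' w0 l0 -> w0 b 0 = w0 a 0.
  move=> st; apply: (step_win_eq st) => //.
  by apply: (@win_mset_reindex _ _ _ _ id).
have step_ik w' l' w0 l0 : w' b 0 = w' a 0 -> win_loss_step A w' l' w0 l0 ->
    w0 k 0 = w0 i 0 /\ l0 k 0 = l0 i 0.
  move=> w'ab st; split; last first.
    by apply: (step_loss_eq st) => //; apply: loss_mset_same_losses.
  apply: (step_win_eq st) => //; apply: (win_mset_reindex (@perm_inj _ (tperm a b))) => //.
  by move=> j; case: tpermP => [->|->|].
(* At order 0 the vector is constant; at every higher order [step_ab] applies to the last step. *)
have order_ab t w0 l0 : win_loss_index_order A t w0 l0 -> w0 b 0 = w0 a 0.
  case: t => [[-> _]|t /= [w' [l' [_ /step_ab]]] //].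
  by rewrite !mxE.
case=> ws [ls [phi [psi [wls E]]]].
suff E' : (fun t => (ws t k 0, ls t k 0)) =1 (fun t => (ws t i 0, ls t i 0)).
  by have [-> ->] := E k; have [-> ->] := E i; rewrite (boolp.funext E').
move=> t; suff [-> ->] : ws t k 0 = ws t i 0 /\ ls t k 0 = ls t i 0 by [].
have [[[|d]]|] := wls t.
- by case=> -> ->; rewrite !mxE.
- by case=> w' [l' [/order_ab w'ab]]; apply: step_ik.
(* An index of infinite order is its own predecessor, so the same step serves twice. *)
- by move=> st; apply: step_ik (st); apply: step_ab st.
Qed.

End Reindexing.

(** * One-individual profiles without ties, encoded as asymmetric digraphs *)

Section Digraph.
Context {R : realType} {n : nat} (e : rel 'I_n).
Hypothesis e_asym : forall i j, e i j -> ~~ e j i.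

Definition digraph_comparisons : {ffun 'I_1 -> 'M[option R]_n} :=
  [ffun => \matrix_(i, j) if i == j then Some 0 else if e i j then Some 1
                          else if e j i then Some 0 else None].

Lemma digraph_diag : [forall p, forall i, digraph_comparisons p i i == Some 0].
Proof. by apply/forallP => p; apply/forallP => i; rewrite ffunE mxE eqxx. Qed.

Lemma digraph_pairs : [forall p, forall i, forall j, (i != j) ==>
  admissible_pair (digraph_comparisons p i j) (digraph_comparisons p j i)].
Proof.
apply/forallP => p; apply/forallP => i; apply/forallP => j; apply/implyP => ij.
rewrite ffunE !mxE [j == i]eq_sym (negbTE ij).
have := @e_asym i j; rewrite /admissible_pair !inE.
by case: (e i j); case: (e j i); rewrite ?eqxx ?orbT //; move/(_ isT).
Qed.

Definition digraph_profile : profile R n 1 :=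
  Profile (ltn0Sn 0) digraph_diag digraph_pairs.

Lemma digraph_irrefl i : e i i = false.
Proof. by apply/negP => eii; move/negP: (e_asym eii). Qed.

Lemma pooled_digraph i j : pooled digraph_profile i j = (e i j)%:R.
Proof.
rewrite /pooled big_mkcond big_ord1 /= ffunE mxE.
by case: eqP => [->|_]; rewrite ?digraph_irrefl //; case: (e i j); case: (e j i).
Qed.

Lemma in_outcomes_digraph i x :
  (x \in outcomes digraph_profile i) = e i x.1 || e x.1 i.
Proof.
rewrite inE /= ffunE mxE [x.1 == i]eq_sym; case: eqP => [<-|_] /=.
  by rewrite digraph_irrefl.
by case: (e i x.1); case: (e x.1 i).
Qed.

Lemma outcome_digraph i x : outcome digraph_profile i x = (e i x.1)%:R.
Proof.
rewrite /outcome /= ffunE mxE; case: eqP => [<-|_]; first by rewrite digraph_irrefl.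
by case: (e i x.1); case: (e x.1 i).
Qed.

(** If no arc led from [J2] into [J1], then [J1] would contain every predecessor of its members. A
    closed walk through all vertices, repetitions allowed, joins a point of [J2] to one of [J1], and
    following it backwards puts that point in [J1]. *)
Lemma indivisible_digraph (c : seq 'I_n) :
  path.cycle e c -> (forall i, i \in c) -> indivisible digraph_profile.
Proof.
move=> ec c_all [J1 [J2 [/set0Pn[x xJ1] /set0Pn[y yJ2] JT dis noarc]]].
have closedJ1 u v : v \in J1 -> e u v -> u \in J1.
  move=> vJ1 euv; have : u \in J1 :|: J2 by rewrite JT inE.
  rewrite inE => /orP[//|uJ2]; case: (noarc u v uJ2 vJ1).
  by rewrite pooled_digraph euv ltr01.
have /connectP[p ep xE] := connect_cycle ec (c_all y) (c_all x).
suff yJ1 : y \in J1 by move: (disjointFr dis yJ1); rewrite yJ2.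
rewrite {}xE in xJ1; elim: p y {yJ2} ep xJ1 => //= z p IHp y /andP[eyz ep] lJ1.
exact: closedJ1 (IHp z ep lJ1) eyz.
Qed.

(** The first parts are the wins of [i] over [X] and the losses of [j] to [sigma] of [X]. Elsewhere
    [sigma] pairs comparisons with equal outcomes, so only the opponents' scores remain to be
    compared. *)
Lemma scm_digraph (S : scoring_map R) (i j : 'I_n) (X : {set 'I_n})
    (sigma : 'I_n -> 'I_n) (s := S n 1 digraph_profile) :
  self_consistent_monotone (@all_indivisible R) S ->
  indivisible digraph_profile -> injective sigma ->
  (forall k, k \in X -> e i k && e (sigma k) j) ->
  (forall k, k \notin X -> e j (sigma k) = e i k /\ e (sigma k) j = e k i) ->
  (forall k, k \notin X -> e i k || e k i -> s (sigma k) 0 <= s k 0) ->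
  s j 0 <= s i 0 /\
  (X != set0 \/
     (exists k, [/\ k \notin X, e i k || e k i & s (sigma k) 0 < s k 0]) ->
   s j 0 < s i 0).
Proof.
move=> scm indiv inj_s eX eNX le_s.
pose pi (x : 'I_n * 'I_1) := (sigma x.1, x.2).
have inj_pi : injective pi by case=> [k p] [k' p'] [/inj_s-> ->].
pose A := digraph_profile.
pose U1 := [set x : 'I_n * 'I_1 | x.1 \in X].
pose U2 := outcomes A i :\: U1.
have piP y : exists x, y = pi x.
  by exists (invF inj_s y.1, y.2); rewrite /pi f_invF; case: y.
have mem_pi (x : 'I_n * 'I_1) (V : {set _}) : (pi x \in pi @: V) = (x \in V).
  by rewrite mem_imset.
have [] := scm _ _ A indiv i j U1 U2 (pi @: U1) (pi @: U2) pi.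
- split.
  + split; last by rewrite -setI_eq0; apply/eqP/setP => x; rewrite !inE; case: (_ \in X).
    apply/setP => x; rewrite in_setU in_setD in_outcomes_digraph [x \in U1]inE.
    by case: (boolP (_ \in X)) => //= /eX /andP[->].
  + split.
      apply/setP => y; have [x ->] := piP y.
      rewrite in_setU !mem_pi in_setD !in_outcomes_digraph [x \in U1]inE /=.
      case: (boolP (_ \in X)) => /= [/eX /andP[_ ->]|/eNX[-> ->] //].
      by rewrite orbT.
    rewrite -setI_eq0; apply/eqP/setP => y; have [x ->] := piP y.
    by rewrite inE !mem_pi !inE; case: (_ \in X).
  + split=> [x|y]; rewrite ?inE outcome_digraph; first by case/eX/andP => ->.
    have [x ->] := piP y; rewrite mem_pi inE /= => /eX /andP[_ /e_asym].
    by case: (e j _).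
  + by split=> // x y _ _; apply: inj_pi.
  + move=> x; rewrite in_setD in_outcomes_digraph inE => /andP[xX ex].
    by rewrite !outcome_digraph /= (eNX _ xX).1 lexx; split=> //; apply: le_s.
- move=> le_ji lt_ji; split=> // -[/set0Pn[k kX]|[k [kX ek ltk]]]; apply: lt_ji.
  + by apply: Or31; apply/set0Pn; exists (k, ord0); rewrite inE.
  + by apply: Or33; exists (k, ord0); [rewrite in_setD in_outcomes_digraph inE kX | right].
Qed.

End Digraph.

(** * The seven-alternative counterexample *)

Definition beats : rel 'I_7 := fun i j => (i : nat, j : nat) \in
  [:: (0, 1); (0, 2); (0, 3); (0, 4); (1, 5); (2, 6); (3, 5); (4, 6); (3, 4);
      (5, 0); (6, 0)]%N.

(* An automorphism of [beats] except for the win of 3 over 4. *)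
Definition mirror (i : 'I_7) : 'I_7 :=
  inord (nth 0 [:: 0; 2; 1; 4; 3; 6; 5] i)%N.

Notation "''o_' k" := (@Ordinal 7 k isT) (at level 8, format "''o_' k").

Lemma forall_ord7 (P : 'I_7 -> Prop) :
  P 'o_0 -> P 'o_1 -> P 'o_2 -> P 'o_3 -> P 'o_4 -> P 'o_5 -> P 'o_6 ->
  forall i, P i.
Proof.
move=> P0 P1 P2 P3 P4 P5 P6 [[|[|[|[|[|[|[|//]]]]]]] lt_i];
  by rewrite (bool_irrelevance lt_i isT).
Qed.

Lemma beats_asym i j : beats i j -> ~~ beats j i.
Proof. by move: i j; do 2![elim/forall_ord7]. Qed.

Lemma mirrorE : [/\ mirror 'o_0 = 'o_0, mirror 'o_1 = 'o_2, mirror 'o_2 = 'o_1,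
  mirror 'o_3 = 'o_4 & [/\ mirror 'o_4 = 'o_3, mirror 'o_5 = 'o_6 & mirror 'o_6 = 'o_5]].
Proof. by do !split; apply/val_inj; rewrite /= inordK. Qed.

Lemma mirrorK : involutive mirror.
Proof.
have [m0 m1 m2 m3 [m4 m5 m6]] := mirrorE.
by elim/forall_ord7; rewrite ?(m0, m1, m2, m3, m4, m5, m6).
Qed.

Lemma beats_mirror i j :
  ~~ ((i \in [:: 'o_3; 'o_4]) && (j \in [:: 'o_3; 'o_4])) ->
  beats (mirror i) (mirror j) = beats i j.
Proof.
have [m0 m1 m2 m3 [m4 m5 m6]] := mirrorE.
by move: i j; do 2!elim/forall_ord7; rewrite ?(m0, m1, m2, m3, m4, m5, m6).
Qed.

Theorem theorem8 (R : realType) (S : scoring_map R) :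
  scoring_procedure (@all_indivisible R) S ->
  win_loss_combining (@all_indivisible R) S ->
  ~ self_consistent_monotone (@all_indivisible R) S.
Proof.
move=> _ combining scm.
have [m0 m1 m2 m3 [m4 m5 m6]] := mirrorE.
have mE := (m0, m1, m2, m3, m4, m5, m6).
have minj := inv_inj mirrorK.
pose A := @digraph_profile R _ beats beats_asym.
have pooledE := @pooled_digraph R _ beats beats_asym.
have indiv : indivisible A.
  (* Three circuits through 0 joined into one closed walk that visits every alternative. *)
  apply: (@indivisible_digraph _ _ _ _ [:: 'o_0; 'o_1; 'o_5; 'o_0; 'o_2; 'o_6;
                                          'o_0; 'o_3; 'o_4; 'o_6]) => //.
  by elim/forall_ord7.
pose s := S 7 1 A.
have s12 : s 'o_2 0 = s 'o_1 0.
  have [w [l [h [wl sE]]]] := combining 7 1 A indiv.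
  suff [w12 l12] : w 'o_2 0 = w 'o_1 0 /\ l 'o_2 0 = l 'o_1 0.
    by rewrite /s !sE w12 l12.
  apply: (@win_loss_index_eq _ _ _ A w l 'o_5 'o_6) (wl).
  - by apply: (cplus_reindex minj) => j; rewrite !pooledE -m5 beats_mirror.
  - by apply: (cminus_reindex minj) => j; rewrite !pooledE -m5 beats_mirror // andbF.
  - by apply: (cplus_reindex minj) => j; rewrite !pooledE -m1 beats_mirror.
  - by apply: (cminus_reindex minj) => j; rewrite !pooledE -m1 beats_mirror // andbF.
  - by move=> j; rewrite !pooledE; elim/forall_ord7: j.
  - by move=> j; rewrite !pooledE; elim/forall_ord7: j; rewrite ?(tpermL, tpermR, tpermD).
  - by move=> j; rewrite !pooledE; elim/forall_ord7: j.
(* Away from 3 and 4 the mirror preserves all outcomes, so SCM applies with both first parts empty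
   and strictness must come from an opponent's score. *)
have scm_mirror i : i \notin [:: 'o_3; 'o_4] ->
    (forall k, beats i k || beats k i -> s (mirror k) 0 <= s k 0) ->
    (exists k, (beats i k || beats k i) && (s (mirror k) 0 < s k 0)) ->
    s (mirror i) 0 < s i 0.
  move=> i34 le_s [k /andP[ik ltk]].
  have [k0|k0 _|k0 _ /le_s//|_] :=
    @scm_digraph _ _ _ beats_asym S i (mirror i) set0 mirror scm indiv minj.
  - by rewrite inE.
  - by rewrite !beats_mirror // (negbTE i34) ?andbF.
  - by apply; right; exists k; rewrite inE.
(* Both 1 and 2 lose to 0 only; their single wins, over 5 and 6, would carry any gap between 5 and 6
   over to 1 and 2. *)
have s56 : s 'o_6 0 = s 'o_5 0.
  case: (ltgtP (s 'o_6 0) (s 'o_5 0)) => // lt_s.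
  - suff: s (mirror 'o_1) 0 < s 'o_1 0 by rewrite m1 s12 ltxx.
    apply: scm_mirror => //; last by exists 'o_5; rewrite m5 lt_s.
    by elim/forall_ord7; rewrite ?mE // => _; exact: ltW.
  - suff: s (mirror 'o_2) 0 < s 'o_2 0 by rewrite m2 s12 ltxx.
    apply: scm_mirror => //; last by exists 'o_6; rewrite m6 lt_s.
    by elim/forall_ord7; rewrite ?mE // => _; exact: ltW.
(* With [X] equal to {4}, the first parts hold the one comparison of 3 with 4, seen from either
   side. The other opponents 0 and 5 of 3 mirror to 0 and 6, which have the same scores. *)
have s34 : s 'o_4 0 < s 'o_3 0.
  have [|k|k|_] :=
    @scm_digraph _ _ _ beats_asym S 'o_3 'o_4 [set 'o_4] mirror scm indiv minj.
  - by move=> k; rewrite inE => /eqP->; rewrite m4.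
  - by rewrite inE; elim/forall_ord7: k; rewrite ?mE.
  - by rewrite inE; elim/forall_ord7: k; rewrite ?mE // -/A -/s ?s56.
  - by apply; left; apply/set0Pn; exists 'o_4; rewrite inE.
suff: s 'o_6 0 < s 'o_5 0 by rewrite s56 ltxx.
(* The opponents 0, 1, 3 of 5 mirror to 0, 2, 4: the first two pairs tie and the third is strict. *)
rewrite -m5; apply: scm_mirror => //; last by exists 'o_3; rewrite m3 s34.
by elim/forall_ord7; rewrite ?mE ?s12 // => _; exact: ltW.
Qed.
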